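(* Consider the instrumental-variables model described in the context, with first-stage coefficient $\pi_1 \neq 0$, and suppose that either Assumption A or Assumption B holds. Let $(\lambda_n)$ be a sequence of penalty parameters with $\lambda_n = o(n)$, i.e. $\lambda_n/n \to 0$. Then the ridge IV estimator \[ \hat\beta_{\text{ridge}} = \frac{\sum_{i=1}^n (Y_i-\bar Y)(Z_i-\bar Z)}{\sum_{i=1}^n (D_i-\bar D)(Z_i-\bar Z) + \lambda_n} \] is consistent: $\hat\beta_{\text{ridge}} \xrightarrow{p} \beta_1$ as $n\to\infty$.
   Context: Data model: for each sample size $n$, observations $(Y_i,D_i,Z_i)$, $i=1,\dots,n$, satisfy $Y_i=\beta_0+\beta_1 D_i+\epsilon_i$ and $D_i=\pi_0+\pi_1 Z_i+\eta_i$, where the error pairs $(\epsilon_i,\eta_i)$ are i.i.d. across $i$ with mean zero, $\mathrm{Var}(\epsilon_i)=\sigma_\epsilon^2<\infty$, $\mathrm{Var}(\eta_i)=\sigma_\eta^2<\infty$ and $\mathrm{Cov}(\epsilon_i,\eta_i)=\sigma_{\epsilon\eta}$ (the errors may be correlated, i.e. $D_i$ is endogenous), and the instruments $Z_i$ are independent of the errors. Bars denote sample means, e.g. $\bar Y=\frac1n\sum_i Y_i$. The penalty $\lambda_n$ is a deterministic sequence of nonnegative reals. Assumption A (instruments as constants): the analysis is conditional on the instruments, so $Z_1,Z_2,\dots$ is a deterministic real sequence, with $\frac1n\sum_{i=1}^n Z_i^2\to 1$ and $\frac1n\sum_{i=1}^n Z_i \to 0$. Assumption B (stochastic instruments): the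 $Z_i$ are i.i.d. random variables, independent of the errors, with $\mathrm{Var}(Z_i)=1$ and finite fourth moment $m_4=E[Z_i^4]$. *)

(* Defs.v *)
From HB Require Import structures.
From mathcomp Require Import all_boot all_order all_algebra.
From mathcomp Require Import all_classical all_reals all_analysis.
Set Implicit Arguments. Unset Strict Implicit. Unset Printing Implicit Defensive.
Import Order.TTheory GRing.Theory Num.Theory.
Import numFieldNormedType.Exports.
Local Open Scope classical_set_scope.
Local Open Scope ring_scope.

Section defs.
Context (d : measure_display) (T : measurableType d) (R : realType) (P : probability T R).

Definition mutual_indep (F : nat -> set (set T)) : Prop :=
  forall (s : seq nat) (A : nat -> set T), uniq s ->
    (forall j, j \in s -> F j (A j)) ->
    P (\bigcap_(j in [set` s]) A j) = (\prod_(j <- s) P (A j))%E.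

Definition indep2 (F G : set (set T)) : Prop :=
  forall A B, F A -> G B -> P (A `&` B) = (P A * P B)%E.

Definition sigmaR (X : T -> R) : set (set T) :=
  [set X @^-1` B | B in [set B : set R | measurable B]].

Definition sigmaR2 (X : T -> R * R) : set (set T) :=
  [set X @^-1` B | B in [set B : set (R * R) | measurable B]].

Definition sigmaR3 (X : T -> R * (R * R)) : set (set T) :=
  [set X @^-1` B | B in [set B : set (R * (R * R)) | measurable B]].

Definition cvg_in_prob (X : nat -> T -> R) (c : R) : Prop :=
  forall e : R, 0 < e ->
    (fun n => P [set w | e <= `|X n w - c|]) @ \oo --> 0%E.

End defs.

Definition smean (R : realType) (x : nat -> R) (n : nat) : R :=
  n%:R^-1 * \sum_(i < n) x i.

Definition ridge_iv (R : realType) (Y D Z : nat -> R) (lam : R) (n : nat) : R :=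
  (\sum_(i < n) (Y i - smean Y n) * (Z i - smean Z n)) /
  (\sum_(i < n) (D i - smean D n) * (Z i - smean Z n) + lam).

(* Main.v *)
(** Write s_xz for the sample covariance. Substituting the two model equations
gives, with A_n = pi1 s_ZZ + s_etaZ,
<<
  ridge = (beta1 A_n + s_epsZ) / (A_n + lam_n / n).
>>
Sample covariances with the errors tend to 0 in probability and s_ZZ tends to 1:
under Assumption A because the weighted means of z_i eps_i have variance
sigma^2 / n times the mean of z_i^2, under Assumption B by the weak law of large
numbers for the i.i.d. square-integrable variables Z, Z^2, Z eps, Z eta. Both
cases follow from one Chebyshev bound for weighted means of pairwise
uncorrelated variables; the continuous mapping theorem then yields the limit
beta1 pi1 / pi1. *)

Require Import Defs.
From HB Require Import structures.
From mathcomp Require Import all_boot all_order all_algebra.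
From mathcomp Require Import all_classical all_reals all_analysis.
From mathcomp Require Import measurable_realfun ring.
Import Order.TTheory GRing.Theory Num.Theory.
Import numFieldNormedType.Exports.
Local Open Scope classical_set_scope.
Local Open Scope ring_scope.
Set Implicit Arguments. Unset Strict Implicit. Unset Printing Implicit Defensive.

(** Since [x^-1 = x * (|x|^-1)^2], inversion reduces to products and real powers, which are
    measurable; at [0] both sides are [0]. *)
Lemma measurable_funV (d : measure_display) (T : measurableType d) (R : realType)
    (f : T -> R) :
  measurable_fun setT f -> measurable_fun setT (fun x => (f x)^-1).
Proof.
move=> mf.
have -> : (fun x => (f x)^-1) = (fun x => f x * (`|f x| `^ (-1)) ^+ 2).
  apply/funext => x; rewrite powR_inv1 ?normr_ge0// exprVn real_normK ?num_real//.
  have [->|fx0] := eqVneq (f x) 0; first by rewrite invr0 mul0r.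
  by rewrite expr2 invfM mulrA mulfV// mul1r.
apply: measurable_funM => //; apply: measurable_funX.
apply: (measurableT_comp (measurable_powR _)).
exact: measurableT_comp.
Qed.

(** * Calculus of convergence in probability *)

Section convergence_in_probability.
Context (d : measure_display) (T : measurableType d) (R : realType)
  (P : probability T R).

(* Measurability is part of the notion because [P] is only meaningful (monotone,
   subadditive) on measurable sets. *)
Definition consistent (X : nat -> T -> R) (c : R) :=
  (forall n, measurable_fun setT (X n)) /\ cvg_in_prob P X c.

Lemma measurable_deviation (X : T -> R) (c e : R) : measurable_fun setT X ->
  measurable [set w | e <= `|X w - c|].
Proof.
move=> mX.
have mn : measurable_fun setT (fun w => `|X w - c|).
  apply: measurableT_comp => //; exact: measurable_funB.
have := measurable_fun_ler (measurable_cst e) mn.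
by move=> /(_ measurableT [set true]); rewrite setTI; exact.
Qed.

(** Continuous mapping theorem in two variables: a deviation of [f (X n, Y n)] forces a deviation of
    [X n] or of [Y n], and the union bound applies. Continuity is asked at the limit point alone, so
    that division is covered; measurability of the composite is therefore a separate hypothesis. *)
Lemma consistent_continuous2 (f : R * R -> R) (X Y : nat -> T -> R) (a b : R) :
  f p @[p --> (a, b)] --> f (a, b) ->
  consistent X a -> consistent Y b ->
  (forall n, measurable_fun setT (fun w => f (X n w, Y n w))) ->
  consistent (fun n w => f (X n w, Y n w)) (f (a, b)).
Proof.
move=> fab [mX Xa] [mY Yb] mf; split => // e e0.
(* Radii [r] and [s] of a box around [(a, b)] that [f] maps into the [e]-ball around its value. *)
have /fab [[U V] /= [/nbhs_ballP[r r0 rU] /nbhs_ballP[s s0 sV]] UV] :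
  nbhs (f (a, b)) (ball (f (a, b)) e) by exact: nbhsx_ballx.
have := cvgeD (fin_num_adde_defr _ (erefl : (0 : \bar R)%E \is a fin_num)) (Xa _ r0) (Yb _ s0).
rewrite adde0 => PXY; apply: (squeeze_cvge (f := cst 0%E)); [|exact: cvg_cst|exact: PXY].
apply: nearW => n; rewrite measure_ge0/=.
have mXr := measurable_deviation a r (mX n).
have mYs := measurable_deviation b s (mY n).
apply: (le_trans _ (measureU2 _ mXr mYs)).
apply: le_measure; rewrite ?inE; [exact: measurable_deviation|exact: measurableU|].
move=> w /= efw; have [Xr|Xr] := leP r `|X n w - a|; first by left.
have [Ys|Ys] := leP s `|Y n w - b|; first by right.
have /= := UV (X n w, Y n w).
rewrite /ball/= distrC ltNge efw => /(_ _)/wrap[|//]; split => /=.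
- by apply: rU; rewrite /ball/= distrC.
- by apply: sV; rewrite /ball/= distrC.
Qed.

Lemma consistentD (X Y : nat -> T -> R) (a b : R) :
  consistent X a -> consistent Y b ->
  consistent (fun n w => X n w + Y n w) (a + b).
Proof.
move=> Xa Yb; apply: (@consistent_continuous2 (fun p => p.1 + p.2) _ _ _ _ _ Xa Yb).
- by apply: cvgD; [exact: cvg_fst|exact: cvg_snd].
- by move=> n; apply: measurable_funD; [exact: Xa.1|exact: Yb.1].
Qed.

Lemma consistentM (X Y : nat -> T -> R) (a b : R) :
  consistent X a -> consistent Y b ->
  consistent (fun n w => X n w * Y n w) (a * b).
Proof.
move=> Xa Yb; apply: (@consistent_continuous2 (fun p => p.1 * p.2) _ _ _ _ _ Xa Yb).
- by apply: cvgM; [exact: cvg_fst|exact: cvg_snd].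
- by move=> n; apply: measurable_funM; [exact: Xa.1|exact: Yb.1].
Qed.

Lemma consistent_div (X Y : nat -> T -> R) (a b : R) : b != 0 ->
  consistent X a -> consistent Y b ->
  consistent (fun n w => X n w / Y n w) (a / b).
Proof.
move=> b0 Xa Yb; apply: (@consistent_continuous2 (fun p => p.1 / p.2) _ _ _ _ _ Xa Yb).
- by apply: cvgM; [exact: cvg_fst|apply: cvgV => //; exact: cvg_snd].
- move=> n; apply: measurable_funM; first exact: Xa.1.
  by apply: measurable_funV; exact: Yb.1.
Qed.

Lemma consistent_deterministic (u : nat -> R) (c : R) :
  u n @[n --> \oo] --> c -> consistent (fun n _ => u n) c.
Proof.
move=> uc; split=> [n|e e0]; first exact: measurable_cst.
(* The deviation event is eventually empty. *)
apply: cvg_near_cst; have /cvgrPdist_lt/(_ _ e0) := uc.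
apply: filterS => n cun; rewrite -(measure0 P); congr (P _).
by rewrite -subset0 => w /=; rewrite distrC leNgt cun.
Qed.

Lemma consistentB (X Y : nat -> T -> R) (a b : R) :
  consistent X a -> consistent Y b ->
  consistent (fun n w => X n w - Y n w) (a - b).
Proof.
move=> Xa Yb; apply: (@consistent_continuous2 (fun p => p.1 - p.2) _ _ _ _ _ Xa Yb).
- by apply: cvgB; [exact: cvg_fst|exact: cvg_snd].
- by move=> n; apply: measurable_funB; [exact: Xa.1|exact: Yb.1].
Qed.

(** Chebyshev bounds the probability that [S n] deviates from its own mean [m n] by [v n / e^2];
    adding back the deterministic sequence [m] then moves the limit from [0] to [c]. *)
Lemma consistent_variance (S : nat -> T -> R) (m v : nat -> R) (c : R) :
  (forall n, S n \in Lfun P 2%:E) ->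
  (forall n, 'E_P[S n] = (m n)%:E)%E -> (forall n, 'V_P[S n] = (v n)%:E)%E ->
  m n @[n --> \oo] --> c -> v n @[n --> \oo] --> 0 -> consistent S c.
Proof.
move=> S2 Sm Sv mc v0.
have mS n : measurable_fun setT (S n) by have /andP[+ _] := S2 n; rewrite inE.
suff S0 : consistent (fun n w => S n w - m n) 0.
  have := consistentD S0 (consistent_deterministic mc).
  by rewrite add0r; congr consistent; apply/funext => n; apply/funext => w; rewrite subrK.
split=> [n|e e0]; first exact: measurable_funB.
apply: (squeeze_cvge (f := cst 0%E) (h := fun n => (e ^- 2 * v n)%:E)).
- apply: nearW => n; rewrite measure_ge0/=.
  pose X : {RV P >-> R} := mfun_Sub (mem_set (mS n)).
  have := chebyshev X e0.
  by rewrite /X/= Sm Sv/= -EFinM; under eq_set do rewrite -[X in `|X|]subr0.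
- exact: cvg_cst.
- apply: cvg_EFin; first exact: nearW.
  rewrite -[X in _ --> X](mulr0 (e ^- 2)).
  by apply: cvgM => //; exact: cvg_cst.
Qed.

End convergence_in_probability.

(** * Moments, equality in law and independence *)

Section random_variables.
Context (d : measure_display) (T : measurableType d) (R : realType)
  (P : probability T R).

Lemma Lfun_measurable (p : \bar R) (X : T -> R) :
  X \in Lfun P p -> measurable_fun setT X.
Proof. by move=> /andP[+ _]; rewrite inE. Qed.

Lemma Lfun2_Lfun1 (X : T -> R) : X \in Lfun P 2%:E -> X \in Lfun P 1.
Proof. by apply: Lfun_subset12; exact: fin_num_measure. Qed.

Lemma sqr_integrable_Lfun2 (X : T -> R) : measurable_fun setT X ->
  P.-integrable setT (fun w => (X w ^+ 2)%:E) -> X \in Lfun P 2%:E.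
Proof.
move=> mX /integrableP[_ X2]; apply/andP; split; rewrite inE//=.
rewrite /finite_norm unlock /Lnorm/=.
rewrite poweR_lty//; move: X2; congr (_ < _)%E; apply: eq_integral => w _ /=.
by rewrite powR_mulrn// normrX.
Qed.

(** Both expectations are integrals of [f] against the same law. Integrability is transferred first,
    through the nonnegative function [|f|], because the signed change of variables requires it. *)
Lemma identically_distributed_integral (d' : measure_display)
    (V : measurableType d') (X Y : T -> V) (f : V -> R) :
  measurable_fun setT X -> measurable_fun setT Y -> measurable_fun setT f ->
  (forall B, measurable B -> P (X @^-1` B) = P (Y @^-1` B)) ->
  P.-integrable setT (EFin \o (f \o Y)) ->
  P.-integrable setT (EFin \o (f \o X)) /\ ('E_P[f \o X] = 'E_P[f \o Y])%E.
Proof.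
move=> mX mY mf XY iY.
have mEf : measurable_fun setT (EFin \o f) by exact/measurable_EFinP.
pose X' : {RV P >-> V} := mfun_Sub (mem_set mX).
pose Y' : {RV P >-> V} := mfun_Sub (mem_set mY).
have iX : P.-integrable setT (EFin \o (f \o X)).
  apply/integrableP; split; first exact: (measurableT_comp mEf).
  have /integrableP[_] := iY.
  have mnf : measurable_fun setT (abse \o (EFin \o f)) by exact: measurableT_comp.
  have nf0 y : (0 <= (abse \o (EFin \o f)) y)%E by exact: abse_ge0.
  rewrite -(ge0_integral_distribution X' mnf nf0).
  rewrite -(ge0_integral_distribution Y' mnf nf0).
  congr (_ < _)%E; apply/eq_measure_integral => A mA _.
  by rewrite /= /distribution/= /pushforward XY.
split => //; rewrite unlock.
rewrite -(@integral_distribution _ _ _ _ _ P X' _ mEf iX).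
rewrite -(@integral_distribution _ _ _ _ _ P Y' _ mEf iY).
by apply/eq_measure_integral => A mA _; exact: XY.
Qed.

(** Fubini for the function [x * y] under the joint law, which independence turns into a product
    measure. *)
Lemma indep2_expectationM (X Y : T -> R) :
  indep2 P (sigmaR X) (sigmaR Y) ->
  X \in Lfun P 1 -> Y \in Lfun P 1 ->
  (X \* Y)%R \in Lfun P 1 /\ ('E_P[X \* Y] = 'E_P[X] * 'E_P[Y])%E.
Proof.
move=> XY LX LY.
have mX := Lfun_measurable LX; have mY := Lfun_measurable LY.
have mXY : measurable_fun setT (fun w => (X w, Y w)) by exact: measurable_fun_pair.
pose X' : {RV P >-> R} := mfun_Sub (mem_set mX).
pose Y' : {RV P >-> R} := mfun_Sub (mem_set mY).
pose XY' : {RV P >-> (R * R)%type} := mfun_Sub (mem_set mXY).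
(* Independence says that the law of (X, Y) is the product of the laws. *)
have prodE A : measurable A ->
    (distribution P X' \x distribution P Y')%E A = distribution P XY' A.
  apply: product_measure_unique => B C mB mC.
  rewrite /distribution/= /pushforward/= -XY; [|by exists B|by exists C].
  done.
pose f (p : R * R) := (p.1 * p.2)%:E.
have mf : measurable_fun setT f.
  by apply/measurable_EFinP; apply: measurable_funM.
have iR (Z : {RV P >-> R}) : P.-integrable setT (EFin \o Z) ->
    (distribution P Z).-integrable setT EFin.
  by move=> iZ; exact: integrable_pushforward.
have iX := iR X' ((Lfun1_integrable P X).1 LX).
have iY := iR Y' ((Lfun1_integrable P Y).1 LY).
(* Tonelli: the integral of [|x * y|] is the product of the two finite absolute first moments. *)
have imf : (distribution P X' \x distribution P Y')%E.-integrable setT f.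
  apply/integrable12ltyP => //.
  under eq_integral => x _.
    under eq_integral => y _ do rewrite /f EFinM abseM /=.
    rewrite ge0_integralZl//; last exact: measurableT_comp.
    over.
  rewrite ge0_integralZr//=; last 2 first.
  - exact: measurableT_comp.
  - exact: integral_ge0.
  apply: lte_mul_pinfty; rewrite ?integral_ge0//.
  - by have /integrableP[_] := iX; rewrite ge0_fin_numE// integral_ge0.
  - by have /integrableP[_] := iY.
have if' : P.-integrable setT (f \o XY').
  apply/integrableP; split; first exact: measurableT_comp.
  have mnf : measurable_fun setT (abse \o f) by exact: measurableT_comp.
  rewrite -(ge0_integral_distribution XY' mnf)//; last by move=> y; exact: abse_ge0.
  have /integrableP[_] := imf; congr (_ < _)%E.
  by apply: eq_measure_integral => A mA _; exact: prodE.
split; first exact/Lfun1_integrable.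
rewrite unlock -(@integral_distribution _ _ _ _ _ P XY' _ mf if').
rewrite -(eq_measure_integral _ (fun A mA _ => prodE A mA)).
rewrite -integral12_prod_meas1//.
rewrite -(@integral_distribution _ _ _ _ _ P X' EFin)//; last exact/Lfun1_integrable.
rewrite -(@integral_distribution _ _ _ _ _ P Y' EFin)//; last exact/Lfun1_integrable.
have Yfin := integrable_fin_num measurableT iY.
(* The mean of [Y] is finite, so it enters the outer integral as a constant, matching the inner
   Fubini integral [x * E[Y]]. *)
rewrite -(fineK Yfin) -integralZr//.
apply: eq_integral => x _; rewrite fineK// /fubini_F/f.
under eq_integral do rewrite EFinM.
by rewrite integralZl.
Qed.

End random_variables.

(** * Weak laws of large numbers for weighted means *)

Section law_of_large_numbers.
Context (d : measure_display) (T : measurableType d) (R : realType)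
  (P : probability T R).

Section uncorrelated.
Variables (W : nat -> T -> R) (a : nat -> R) (m v : R).
Hypotheses (W2 : forall i, W i \in Lfun P 2%:E)
  (Wm : forall i, ('E_P[W i] = m%:E)%E) (Wv : forall i, ('V_P[W i] = v%:E)%E)
  (Wcov : forall i j, i <> j -> (covariance P (W i) (W j) = 0)%E).

Let S (n : nat) (w : T) := \sum_(i < n) a i * W i w.

Let SS n : S n.+1 = (S n \+ a n \o* W n)%R.
Proof. by apply/funext => w; rewrite /S big_ord_recr/= [W n w * _]mulrC. Qed.

Let S0 : S 0 = cst 0.
Proof. by apply/funext => w; rewrite /S big_ord0. Qed.

Let aW2 n : (a n \o* W n)%R \in Lfun P 2%:E.
Proof. by apply: Lfun_scale; rewrite ?ler1n. Qed.

Let S2 n : S n \in Lfun P 2%:E.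
Proof.
elim: n => [|n IH]; first by rewrite S0; exact: Lfun_cst.
by rewrite SS rpredD// lee1n.
Qed.

(** [S n] involves only indices below [n]. Every [k >= n] is allowed so that the induction closes;
    the variance recursion uses [k = n]. *)
Let cov_S n k : (n <= k)%N -> (covariance P (S n) (W k) = 0)%E.
Proof.
elim: n => [|n IH] nk; first by rewrite S0 covariance_cst_l.
rewrite SS covarianceDl// IH ?(ltnW nk)// add0e.
rewrite covarianceZl ?Lfun2_mul_Lfun1 ?Lfun2_Lfun1//.
rewrite Wcov ?mule0// => nk'; by rewrite nk' ltnn in nk.
Qed.

Let expectation_S n : ('E_P[S n] = (m * \sum_(i < n) a i)%:E)%E.
Proof.
elim: n => [|n IH]; first by rewrite S0 expectation_cst big_ord0 mulr0.
rewrite SS expectationD ?Lfun2_Lfun1// IH expectationZl ?Lfun2_Lfun1// Wm.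
by rewrite -EFinM -EFinD big_ord_recr/= mulrDr [a n * m]mulrC.
Qed.

Let variance_S n : ('V_P[S n] = (v * \sum_(i < n) a i ^+ 2)%:E)%E.
Proof.
elim: n => [|n IH]; first by rewrite S0 variance_cst big_ord0 mulr0.
rewrite SS varianceD// IH varianceZ// Wv covarianceZr ?Lfun2_mul_Lfun1 ?Lfun2_Lfun1//.
by rewrite cov_S// !mule0 adde0 -EFinM -EFinD big_ord_recr/= mulrDr [_ * v]mulrC.
Qed.

(** The weighted mean has expectation [m] times the mean of the weights, and variance [v / n] times
    the mean of their squares; the latter mean converges, so the variance tends to [0]. *)
Lemma consistent_weighted_mean (al ga : R) :
  smean a n @[n --> \oo] --> al ->
  smean (fun i => a i ^+ 2) n @[n --> \oo] --> ga ->
  consistent P (fun n w => smean (fun i => a i * W i w) n) (m * al).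
Proof.
move=> aal aga.
have smeanE n : (fun w => smean (fun i => a i * W i w) n) = (n%:R^-1 \o* S n)%R.
  by apply/funext => w; rewrite /smean/= mulrC.
apply: (@consistent_variance _ _ _ _ _ (fun n => m * smean a n)
  (fun n => v * (n%:R^-1 * smean (fun i => a i ^+ 2) n))).
- by move=> n; rewrite smeanE; apply: Lfun_scale; rewrite ?ler1n.
- move=> n; rewrite smeanE expectationZl ?Lfun2_Lfun1// expectation_S -EFinM.
  by rewrite mulrCA.
- move=> n; rewrite smeanE varianceZ// variance_S -EFinM.
  by rewrite expr2 /smean mulrCA !mulrA.
- by apply: cvgM => //; exact: cvg_cst.
- rewrite -[X in _ --> X](mulr0 v) -[X in v * X](mul0r ga).
  apply: cvgM; first exact: cvg_cst.
  apply: cvgM => //; apply/gtr0_cvgV0; last exact: cvgr_idn.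
  by exists 1%N => // n /= n0; rewrite ltr0n.
Qed.

End uncorrelated.

(** Equality in law gives all [f (X i)] the same mean and variance, and independence makes them
    uncorrelated. The value space [V] is arbitrary so that one i.i.d. family of pairs or triples
    serves for every coordinate and product of coordinates. *)
Lemma consistent_iid_weighted_mean (d' : measure_display) (V : measurableType d')
    (X : nat -> T -> V) (f : V -> R) (a : nat -> R) (al ga : R) :
  (forall i, measurable_fun setT (X i)) -> measurable_fun setT f ->
  mutual_indep P (fun i => [set X i @^-1` B | B in [set B : set V | measurable B]]) ->
  (forall i (B : set V), measurable B -> P (X i @^-1` B) = P (X 0 @^-1` B)) ->
  f \o X 0 \in Lfun P 2%:E ->
  smean a n @[n --> \oo] --> al ->
  smean (fun i => a i ^+ 2) n @[n --> \oo] --> ga ->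
  consistent P (fun n w => smean (fun i => a i * f (X i w)) n)
    (fine 'E_P[f \o X 0] * al).
Proof.
move=> mX mf Xindep Xid f2 aal aga.
have mf2 : measurable_fun setT (fun x => f x ^+ 2) by exact: measurable_funX.
have id1 i := identically_distributed_integral (mX i) (mX 0) mf (Xid i)
  ((Lfun1_integrable P _).1 (Lfun2_Lfun1 f2)).
have id2 i := identically_distributed_integral (mX i) (mX 0) mf2 (Xid i)
  (Lfun2_integrable_sqr f2).
have mfX i : measurable_fun setT (f \o X i) by exact: measurableT_comp.
have fX2 i : f \o X i \in Lfun P 2%:E.
  by apply: sqr_integrable_Lfun2 => //; exact: (id2 i).1.
have Efin := expectation_fin_num (Lfun2_Lfun1 f2).
apply: (@consistent_weighted_mean (fun i => f \o X i) a _ (fine 'V_P[f \o X 0])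
  fX2 _ _ _ al ga) => //.
- by move=> i; rewrite (id1 i).2 fineK.
- move=> i; rewrite fineK ?variance_fin_num// !varianceE// (id1 i).2.
  by congr (_ - _)%E; exact: (id2 i).2.
- move=> i j ij.
  have [] := @indep2_expectationM _ _ _ P (f \o X i) (f \o X j).
  + move=> A B [A' mA' <-] [B' mB' <-].
    (* Mutual independence is used on the list [[:: i; j]], with a family of events that follows
       [A'] at [i] and [B'] at [j]. *)
    pose C k := X k @^-1` (f @^-1` (if k == i then A' else B')).
    have := Xindep [:: i; j] C.
    rewrite big_cons big_cons big_nil mule1 /C eqxx.
    rewrite (negbTE (introN eqP (nesym ij))) => <-.
    * congr (P _); apply/seteqP; split => w.
      - move=> [Aw Bw] k /=; rewrite !inE => /orP[/eqP->|/eqP->]; first by rewrite eqxx.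
        by rewrite (negbTE (introN eqP (nesym ij))).
      - move=> CW; split.
          by have := CW i; rewrite /= eqxx inE eqxx; exact.
        have := CW j; rewrite /= (negbTE (introN eqP (nesym ij))) !inE eqxx orbT; exact.
    * by rewrite /= inE andbT; apply/eqP.
    * move=> k _; exists (f @^-1` (if k == i then A' else B')) => //=.
      by rewrite -[X in measurable X]setTI; apply: mf => //; case: ifP.
  + exact: Lfun2_Lfun1.
  + exact: Lfun2_Lfun1.
  move=> Lij Eij; rewrite covarianceE ?(Lfun2_Lfun1 (fX2 _))//.
  rewrite [X in (X - _)%E]Eij subee// fin_numM//.
  + exact/expectation_fin_num/Lfun2_Lfun1.
  + exact/expectation_fin_num/Lfun2_Lfun1.
Qed.

Lemma consistent_iid_mean (d' : measure_display) (V : measurableType d')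
    (X : nat -> T -> V) (f : V -> R) :
  (forall i, measurable_fun setT (X i)) -> measurable_fun setT f ->
  mutual_indep P (fun i => [set X i @^-1` B | B in [set B : set V | measurable B]]) ->
  (forall i (B : set V), measurable B -> P (X i @^-1` B) = P (X 0 @^-1` B)) ->
  f \o X 0 \in Lfun P 2%:E ->
  consistent P (fun n w => smean (fun i => f (X i w)) n) (fine 'E_P[f \o X 0]).
Proof.
move=> mX mf Xindep Xid f2.
have mean1 : smean (fun=> 1 : R) n @[n --> \oo] --> (1 : R).
  apply: cvg_near_cst; exists 1%N => // n /= n0.
  by rewrite /smean sumr_const card_ord mulVf// pnatr_eq0 -lt0n.
have mean12 : smean (fun=> 1 ^+ 2 : R) n @[n --> \oo] --> (1 : R).
  by under eq_fun do rewrite expr1n.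
have := consistent_iid_weighted_mean mX mf Xindep Xid f2 mean1 mean12.
rewrite mulr1; congr consistent; apply/funext => n; apply/funext => w.
by rewrite /smean; under eq_bigr do rewrite mul1r.
Qed.

End law_of_large_numbers.

(** * Algebra of sample covariances *)

Section sample_covariance.
Context (R : realType).
Implicit Types x y u z : nat -> R.

(** The uncentred form, in which consistency follows directly from that of three sample means. *)
Definition scov x z (n : nat) : R :=
  smean (fun i => x i * z i) n - smean x n * smean z n.

Lemma scovE x z n :
  n%:R^-1 * \sum_(i < n) (x i - smean x n) * (z i - smean z n) = scov x z n.
Proof.
have [->|n0] := eqVneq n 0%N; first by rewrite /scov /smean !big_ord0 !mulr0 subr0.
have nR : n%:R != 0 :> R by rewrite pnatr_eq0.
have -> : \sum_(i < n) (x i - smean x n) * (z i - smean z n) =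
    \sum_(i < n) x i * z i - smean x n * \sum_(i < n) z i
    - smean z n * \sum_(i < n) x i + n%:R * (smean x n * smean z n).
  have -> : n%:R * (smean x n * smean z n) = \sum_(i < n) smean x n * smean z n.
    by rewrite sumr_const card_ord mulr_natl.
  by rewrite !mulr_sumr -!sumrB -big_split/=; apply: eq_bigr => i _; ring.
by rewrite /scov /smean; field.
Qed.

(** Centring removes the intercept [c]; this is how the two model equations are substituted into the
    estimator. *)
Lemma scov_affine (b c : R) x y u z n : (forall i, x i = c + b * y i + u i) ->
  scov x z n = b * scov y z n + scov u z n.
Proof.
move=> xE; rewrite -!scovE mulrCA -mulrDr; congr (_ * _); rewrite mulr_sumr -big_split/=.
have [->|n0] := eqVneq n 0%N; first by rewrite !big_ord0.
have nR : n%:R != 0 :> R by rewrite pnatr_eq0.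
have -> : smean x n = c + b * smean y n + smean u n.
  rewrite /smean; under eq_bigr do rewrite xE.
  rewrite !big_split/= -mulr_sumr.
  by rewrite sumr_const card_ord -mulr_natl; field.
by apply: eq_bigr => i _; rewrite xE; ring.
Qed.

(* For [n = 0] both sides are [0], since [0 / x = 0] and [0^-1 = 0]. *)
Lemma ridge_ivE x y z lam n :
  ridge_iv y x z lam n = scov y z n / (scov x z n + lam / n%:R).
Proof.
rewrite /ridge_iv -!scovE.
have [->|n0] := eqVneq n 0%N; first by rewrite !big_ord0 mulr0 !mul0r.
have nR : n%:R^-1 != 0 :> R by rewrite invr_eq0 pnatr_eq0.
by rewrite [lam / _]mulrC -mulrDr invfM mulrACA mulfV// mul1r.
Qed.

End sample_covariance.

(** * Consistency of the estimator from that of sample means *)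

Section ridge.
Context (d : measure_display) (T : measurableType d) (R : realType)
  (P : probability T R).

Lemma consistent_scov (X Z : nat -> T -> R) (xz x z : R) :
  consistent P (fun n w => smean (fun i => X i w * Z i w) n) xz ->
  consistent P (fun n w => smean (X ^~ w) n) x ->
  consistent P (fun n w => smean (Z ^~ w) n) z ->
  consistent P (fun n w => scov (X ^~ w) (Z ^~ w) n) (xz - x * z).
Proof.
by move=> cXZ cX cZ; apply: consistentB => //; exact: consistentM.
Qed.

(** Common core of both assumptions: [mu] is the limiting instrument mean, [0] under A and [E[Z]]
    under B, and the limit [1 + mu^2] of the second moments makes the limiting variance [1] in
    either case. *)
Lemma consistent_ridge (beta0 beta1 pi0 pi1 mu : R) (eps eta Z Y D : nat -> T -> R)
    (lam : nat -> R) :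
  pi1 != 0 ->
  (forall i w, Y i w = beta0 + beta1 * D i w + eps i w) ->
  (forall i w, D i w = pi0 + pi1 * Z i w + eta i w) ->
  lam n / n%:R @[n --> \oo] --> (0 : R) ->
  consistent P (fun n w => smean (Z ^~ w) n) mu ->
  consistent P (fun n w => smean (fun i => Z i w * Z i w) n) (1 + mu ^+ 2) ->
  consistent P (fun n w => smean (eps ^~ w) n) 0 ->
  consistent P (fun n w => smean (eta ^~ w) n) 0 ->
  consistent P (fun n w => smean (fun i => eps i w * Z i w) n) 0 ->
  consistent P (fun n w => smean (fun i => eta i w * Z i w) n) 0 ->
  cvg_in_prob P (fun n w => ridge_iv (Y ^~ w) (D ^~ w) (Z ^~ w) (lam n) n) beta1.
Proof.
move=> pi1_neq0 hY hD hlam cZ cZZ ceps ceta cepsZ cetaZ.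
have cst_ c : consistent P (fun (_ : nat) (_ : T) => c) c.
  by apply: consistent_deterministic; exact: cvg_cst.
have sZZ := consistent_scov cZZ cZ cZ.
have sepsZ := consistent_scov cepsZ ceps cZ.
have setaZ := consistent_scov cetaZ ceta cZ.
(* [cDen] concerns the unpenalized denominator [A_n]; the numerator is [beta1 * A_n] plus the
   covariance of [eps] with [Z], and [cDen'] adds the vanishing penalty. *)
have cDen := consistentD (consistentM (cst_ pi1) sZZ) setaZ.
have cNum := consistentD (consistentM (cst_ beta1) cDen) sepsZ.
have cDen' := consistentD cDen (consistent_deterministic P hlam).
have limD : pi1 * (1 + mu ^+ 2 - mu * mu) + (0 - 0 * mu) + 0 = pi1 by ring.
have limN : beta1 * (pi1 * (1 + mu ^+ 2 - mu * mu) + (0 - 0 * mu)) + (0 - 0 * mu)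
  = beta1 * pi1 by ring.
rewrite limD in cDen'; rewrite limN in cNum.
have [_] := consistent_div pi1_neq0 cNum cDen'.
rewrite mulfK//; congr cvg_in_prob; apply/funext => n; apply/funext => w.
rewrite ridge_ivE (scov_affine _ _ (fun i => hY i w)).
by rewrite (scov_affine _ _ (fun i => hD i w)).
Qed.

End ridge.

(** * The two assumptions on the instruments *)

Unset Implicit Arguments.

Theorem mainTheorem1 (d : measure_display) (T : measurableType d) (R : realType)
  (P : probability T R)
  (beta0 beta1 pi0 pi1 : R) (hpi1 : pi1 != 0)
  (eps eta Z : nat -> {RV P >-> R}) (Y D : nat -> T -> R)
  (hY : forall i w, Y i w = beta0 + beta1 * D i w + eps i w)
  (hD : forall i w, D i w = pi0 + pi1 * Z i w + eta i w)
  (* the error pairs (eps_i, eta_i) are i.i.d. across i *)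
  (herr_indep : mutual_indep P (fun i => sigmaR2 (fun w => (eps i w, eta i w))))
  (herr_ident : forall i (B : set (R * R)), measurable B ->
     P ((fun w => (eps i w, eta i w)) @^-1` B) = P ((fun w => (eps 0 w, eta 0 w)) @^-1` B))
  (* mean zero, finite variances (the covariance is arbitrary) *)
  (heps_L2 : P.-integrable setT (fun w => ((eps 0 w) ^+ 2)%:E))
  (heta_L2 : P.-integrable setT (fun w => ((eta 0 w) ^+ 2)%:E))
  (heps_mean : ('E_P[eps 0%N] = 0)%E) (heta_mean : ('E_P[eta 0%N] = 0)%E)
  (* penalty *)
  (lam : nat -> R) (hlam_ge0 : forall n, 0 <= lam n)
  (hlam : (fun n => lam n / n%:R) @ \oo --> (0 : R))
  (* Assumption A or Assumption B *)
  (hZ :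
    (exists z : nat -> R, (forall i w, Z i w = z i) /\
       (fun n => smean (fun i => z i ^+ 2) n) @ \oo --> (1 : R) /\
       (fun n => smean z n) @ \oo --> (0 : R))
    \/
    ((* triples (Z_i, eps_i, eta_i) independent across i and identically distributed,
        so that the Z_i are i.i.d. *)
     mutual_indep P (fun i => sigmaR3 (fun w => (Z i w, (eps i w, eta i w)))) /\
     (forall i (B : set (R * (R * R))), measurable B ->
        P ((fun w => (Z i w, (eps i w, eta i w))) @^-1` B) =
        P ((fun w => (Z 0 w, (eps 0 w, eta 0 w))) @^-1` B)) /\
     (* instruments independent of the errors *)
     (forall i, indep2 P (sigmaR (Z i)) (sigmaR2 (fun w => (eps i w, eta i w)))) /\
     ('V_P[Z 0%N] = 1)%E /\
     P.-integrable setT (fun w => ((Z 0 w) ^+ 4)%:E))) :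
  cvg_in_prob P
    (fun n w => ridge_iv (fun i => Y i w) (fun i => D i w) (fun i => Z i w) (lam n) n)
    beta1.
Proof.
have mpair i : measurable_fun setT (fun w => (eps i w, eta i w)).
  exact: measurable_fun_pair.
have eps2 := sqr_integrable_Lfun2 (measurable_funPT (eps 0%N)) heps_L2.
have eta2 := sqr_integrable_Lfun2 (measurable_funPT (eta 0%N)) heta_L2.
have mfst : measurable_fun setT (fst : R * R -> R) by exact: measurable_fst.
have msnd : measurable_fun setT (snd : R * R -> R) by exact: measurable_snd.
(* The error means tend to [0] under either assumption, by the weak law for the pairs composed with
   a projection. *)
have ceps := consistent_iid_mean mpair mfst herr_indep herr_ident eps2.
have ceta := consistent_iid_mean mpair msnd herr_indep herr_ident eta2.
rewrite [X in fine X](_ : _ = 'E_P[eps 0%N]%E)// heps_mean/= in ceps.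
rewrite [X in fine X](_ : _ = 'E_P[eta 0%N]%E)// heta_mean/= in ceta.
case: hZ => [[z [Zz [z2 z1]]]|[hindep [hident [hindepZ [hvar h4]]]]].
- apply: (@consistent_ridge _ _ _ _ beta0 beta1 pi0 pi1 0 eps eta Z) => //.
  + have := consistent_deterministic P z1; congr consistent.
    apply/funext => n; apply/funext => w.
    by congr smean; apply/funext => i; rewrite Zz.
  + rewrite expr0n addr0; have := consistent_deterministic P z2; congr consistent.
    apply/funext => n; apply/funext => w.
    by congr smean; apply/funext => i; rewrite Zz -expr2.
  (* Under Assumption A the instruments [z i] are the weights; the limit is the error mean times the
     limit [0] of their averages. *)
  + have := consistent_iid_weighted_mean mpair mfst herr_indep herr_ident eps2 z1 z2.
    rewrite mulr0; congr consistent; apply/funext => n; apply/funext => w.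
    by congr smean; apply/funext => i; rewrite Zz mulrC.
  + have := consistent_iid_weighted_mean mpair msnd herr_indep herr_ident eta2 z1 z2.
    rewrite mulr0; congr consistent; apply/funext => n; apply/funext => w.
    by congr smean; apply/funext => i; rewrite Zz mulrC.
- have mZ := measurable_funPT (Z 0%N).
  (* The finite fourth moment puts [Z^2] in L2, as the weak law for [Z^2] demands. *)
  have ZZ2 : (fun w => Z 0%N w * Z 0%N w) \in Lfun P 2%:E.
    apply: sqr_integrable_Lfun2; first exact: measurable_funM.
    by under eq_fun do rewrite -expr2 -exprM.
  have Z2 : (Z 0%N : T -> R) \in Lfun P 2%:E.
    apply: sqr_integrable_Lfun2 => //.
    by under eq_fun do rewrite expr2; exact/Lfun1_integrable/Lfun2_Lfun1.
  (* Unit variance, rewritten as the second moment that [consistent_ridge] expects with [mu =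
     E[Z]]. *)
  have EZZ : fine 'E_P[fun w => (Z 0%N w * Z 0%N w)%R]%E = 1 + fine 'E_P[Z 0%N]%E ^+ 2.
    have := varianceE Z2; rewrite hvar.
    rewrite -(fineK (expectation_fin_num (Lfun2_Lfun1 Z2))).
    rewrite [X in (X - _)%E](_ : _ = 'E_P[fun w => (Z 0%N w * Z 0%N w)%R]%E)//.
    rewrite -(fineK (expectation_fin_num (Lfun2_Lfun1 ZZ2))) -EFin_expe -EFinB => -[->].
    by rewrite subrK.
  (* Treats both errors at once, [p] being the projection that selects one of them. *)
  have ZU (p : R * R -> R) (U : nat -> {RV P >-> R}) : measurable_fun setT p ->
      (forall i w, U i w = p (eps i w, eta i w)) ->
      (U 0%N : T -> R) \in Lfun P 2%:E -> ('E_P[U 0%N] = 0)%E ->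
      (fun w => U 0%N w * Z 0%N w) \in Lfun P 2%:E /\
      ('E_P[fun w => (U 0%N w * Z 0%N w)%R] = 0)%E.
    move=> mp UE U2 EU.
    (* Used twice: with squares, to get [E[U^2 Z^2]] finite, and with identities, to get [E[U Z] =
       E[U] E[Z] = 0]. *)
    have UZindep (f g : R -> R) : measurable_fun setT f -> measurable_fun setT g ->
        indep2 P (sigmaR (f \o U 0%N)) (sigmaR (g \o Z 0%N)).
      move=> mf mg _ _ [A mA <-] [B mB <-]; rewrite setIC muleC.
      apply: (hindepZ 0%N).
      - by exists (g @^-1` B) => //=; rewrite -[X in measurable X]setTI; exact: mg.
      - exists (p @^-1` (f @^-1` A)) => /=.
          rewrite -[X in measurable X]setTI; apply: mp => //.
          by rewrite -[X in measurable X]setTI; exact: mf.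
        by apply/seteqP; split => w /=; rewrite UE.
    split.
      apply: sqr_integrable_Lfun2; first exact: measurable_funM.
      have msqr : measurable_fun setT (fun x : R => x ^+ 2) by exact: measurable_funX.
      have [] := indep2_expectationM (UZindep _ _ msqr msqr).
      + exact/Lfun1_integrable/Lfun2_integrable_sqr.
      + exact/Lfun1_integrable/Lfun2_integrable_sqr.
      move=> /Lfun1_integrable UZ2 _; apply: eq_integrable UZ2 => // w _.
      by rewrite /= exprMn.
    have mid : measurable_fun setT (@idfun R) by exact: measurable_id.
    have [] := indep2_expectationM (UZindep _ _ mid mid).
    + exact: Lfun2_Lfun1.
    + exact: Lfun2_Lfun1.
    by move=> _; rewrite [X in (_ = X * _)%E]EU mul0e.
  have [epsZ2 EepsZ] := ZU fst eps mfst (fun _ _ => erefl) eps2 heps_mean.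
  have [etaZ2 EetaZ] := ZU snd eta msnd (fun _ _ => erefl) eta2 heta_mean.
  have mtriple i : measurable_fun setT (fun w => (Z i w, (eps i w, eta i w))).
    by apply: measurable_fun_pair.
  have m1 : measurable_fun setT (fun t : R * (R * R) => t.1) by exact: measurable_fst.
  have m2 : measurable_fun setT (fun t : R * (R * R) => t.2.1).
    by apply: measurableT_comp => //; exact: measurable_snd.
  have m3 : measurable_fun setT (fun t : R * (R * R) => t.2.2).
    by apply: measurableT_comp => //; exact: measurable_snd.
  (* All four remaining means are averages of functions of the i.i.d. triples: [Z], [Z^2], [eps Z]
     and [eta Z]. *)
  have LLN f mf := @consistent_iid_mean _ _ _ P _ _ _ f mtriple mf hindep hident.
  apply: (@consistent_ridge _ _ _ _ beta0 beta1 pi0 pi1 (fine 'E_P[Z 0%N]%E)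
    eps eta Z) => //.
  + exact: (LLN _ m1).
  + by rewrite -EZZ; exact: (LLN _ (measurable_funM m1 m1)).
  + have := LLN _ (measurable_funM m2 m1) epsZ2.
    by rewrite [X in fine X]EepsZ.
  + have := LLN _ (measurable_funM m3 m1) etaZ2.
    by rewrite [X in fine X]EetaZ.
Qed.
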